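(* Let $n = \binom{m}{2}$ and regard $S_m$ as a subgroup of $S_n$ via its action on the $2$-element subsets of $\{1,\ldots,m\}$. Then the proportion of elements of $S_n$ that lie in some conjugate (in $S_n$) of this subgroup is $O\!\left(\frac{\log n}{n}\right)$ as $m \to \infty$. *)

(* Defs.v *)
From HB Require Import structures.
From mathcomp Require Import all_boot all_order all_algebra all_fingroup.
From mathcomp Require Import all_classical all_reals all_analysis.
Set Implicit Arguments.
Unset Strict Implicit.
Unset Printing Implicit Defensive.
Import Order.TTheory GRing.Theory Num.Theory.
Import numFieldNormedType.Exports.
Local Open Scope ring_scope.

Definition pairs (m : nat) := {A : {set 'I_m} | #|A| == 2}.

Lemma card_pairs (m : nat) : #|{: pairs m}| = 'C(m, 2).
Proof. by rewrite card_sig -[in RHS](card_ord m) -card_draws cardsE. Qed.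

(* A numbering of the 2-element subsets by 'I_n, n = 'C(m, 2), used to realise
   Sym(pairs m) as 'S_n; another numbering would replace the subgroup
   [S_on_pairs m] below by a conjugate of it. *)
Definition pair_rank (m : nat) (A : pairs m) : 'I_('C(m, 2)) :=
  cast_ord (card_pairs m) (enum_rank A).

Definition pair_val (m : nat) (i : 'I_('C(m, 2))) : pairs m :=
  enum_val (cast_ord (esym (card_pairs m)) i).

Lemma pair_rankK (m : nat) : cancel (@pair_rank m) (@pair_val m).
Proof. by move=> A; rewrite /pair_val /pair_rank cast_ordK enum_rankK. Qed.

Lemma pair_valK (m : nat) : cancel (@pair_val m) (@pair_rank m).
Proof. by move=> i; rewrite /pair_val /pair_rank enum_valK cast_ordKV. Qed.

Lemma pair_img_subproof (m : nat) (A : pairs m) (s : 'S_m) :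
  #|s @: val A| == 2.
Proof. by rewrite card_imset; [exact: valP A | exact: perm_inj]. Qed.

Definition pair_img (m : nat) (A : pairs m) (s : 'S_m) : pairs m :=
  exist _ (s @: val A) (pair_img_subproof A s).

Definition pair_act (m : nat) (i : 'I_('C(m, 2))) (s : 'S_m) : 'I_('C(m, 2)) :=
  pair_rank (pair_img (pair_val i) s).

Lemma pair_act1 (m : nat) : @pair_act m ^~ 1%g =1 id.
Proof.
move=> i; rewrite /pair_act -[RHS]pair_valK; congr pair_rank.
apply: val_inj; rewrite /= -[RHS]imset_id.
by apply: eq_imset => x; rewrite perm1.
Qed.


Lemma pair_actM (m : nat) (i : 'I_('C(m, 2))) : act_morph (@pair_act m) i.
Proof.
move=> s t; rewrite /pair_act pair_rankK; congr pair_rank.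
apply: val_inj; rewrite /= -imset_comp.
by apply: eq_imset => x; rewrite /= permM.
Qed.

Definition pair_action (m : nat) : {action 'S_m &-> 'I_('C(m, 2))} :=
  TotalAction (@pair_act1 m) (@pair_actM m).

Definition S_on_pairs (m : nat) : {group 'S_('C(m, 2))} :=
  (actperm (pair_action m) @* [set: 'S_m])%G.

Definition conjugates_union (gT : finGroupType) (H : {group gT}) : {set gT} :=
  (\bigcup_(x : gT) (H :^ x)%g)%SET.

Definition proportion (R : realType) (T : finType) (A : {set T}) : R :=
  #|A|%:R / #|T|%:R.

(* Main.v *)
(* The bound obtained is in fact O(1/n), by a first-moment argument.
   By Burnside's lemma a permutation in S_n leaves n + 1 subsets invariant on
   average, so the proportion of those with at least 2^b invariant subsets is at
   most (n + 1) / 2^b. For a permutation of the pairs induced by s in S_m, an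
   invariant subset is an s-invariant graph on m vertices. If m >= (2b + 1)^2,
   then s has either more than b cycles, and joining one of them to an arbitrary
   set of the others gives 2^b invariant graphs, or a cycle of length greater
   than 2b, and joining its points at distances in an arbitrary subset of
   {1, ..., b} does so. Taking b of order sqrt m makes (n + 1) / 2^b much
   smaller than 1/n. *)
Require Import Defs.
From HB Require Import structures.
From mathcomp Require Import all_boot all_order all_algebra all_fingroup.
From mathcomp Require Import zify.
Set Implicit Arguments.
Unset Strict Implicit.
Unset Printing Implicit Defensive.

(** * Counting the subsets invariant under a permutation *)

Section InvariantSets.
Variable T : finType.
Implicit Types (t x : {perm T}) (A B : {set T}).

Definition inv_sets t : {set {set T}} := [set A : {set T} | t @: A == A].

(** List each set followed by its complement and match the two lists position by position. *)
Lemma exists_perm_imset A B : #|A| = #|B| -> exists t : {perm T}, t @: A = B.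
Proof.
move=> eqAB; pose s (C : {set T}) := enum C ++ enum (~: C).
have uniq_s C : uniq (s C).
  rewrite cat_uniq !enum_uniq andbT /=; apply/hasPn => z.
  by rewrite !mem_enum inE.
have mem_s C z : z \in s C by rewrite mem_cat !mem_enum inE orbN.
have size_s C : size (s C) = #|T| by rewrite size_cat -!cardE cardsC.
pose f z := nth z (s B) (index z (s A)).
have lt_idx z : index z (s A) < size (s B).
  by rewrite size_s -(size_s A) index_mem.
have f_inj : injective f.
  move=> y z; rewrite /f (set_nth_default z) // => /eqP.
  rewrite nth_uniq // => /eqP eq_idx.
  by rewrite -(nth_index y (mem_s A y)) -[RHS](nth_index y (mem_s A z)) eq_idx.
exists (perm f_inj); apply/eqP; rewrite eqEcard card_imset ?eqAB ?leqnn ?andbT;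
  last exact: perm_inj.
apply/subsetP => _ /imsetP[z zA ->]; rewrite permE /f index_cat mem_enum zA.
have lt_z : index z (enum A) < size (enum B).
  by rewrite -cardE -eqAB cardE index_mem mem_enum.
by rewrite nth_cat lt_z -mem_enum mem_nth.
Qed.

(* Burnside's lemma for [Sym T] acting on the subsets of [T]: the orbits are
   the sets of a given cardinality. *)
Lemma sum_card_inv_sets :
  \sum_(t : {perm T}) #|inv_sets t| <= #|T|.+1 * #|{perm T}|.
Proof.
pose to := ('P^* : action [set: {perm T}] {set T})%act.
have acts : [acts [set: {perm T}], on [set: {set T}] | to].
  by apply/actsP => t _ A; rewrite !inE.
have := Frobenius_Cauchy acts.
rewrite cardsT => eqF.
have -> : \sum_(t : {perm T}) #|inv_sets t| =
          \sum_(t in [set: {perm T}]) #|'Fix_([set: {set T}] | to)[t]%g|.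
  apply: eq_big => [t|t _]; first by rewrite inE.
  apply: eq_card => A; rewrite setTI !inE sub1set inE.
  by apply/eqP/eqP.
rewrite eqF leq_mul2r; apply/orP; right.
pose g (i : 'I_#|T|.+1) :=
  orbit to [set: {perm T}] (odflt set0 [pick A : {set T} | #|A| == i]).
have le_g : #|g @: 'I_#|T|.+1| <= #|T|.+1.
  by rewrite -[leqRHS]card_ord leq_imset_card.
apply: leq_trans le_g; apply: subset_leq_card.
apply/subsetP => _ /imsetP[A _ ->].
have ltA : #|A| < #|T|.+1 by rewrite ltnS max_card.
apply/imsetP; exists (Ordinal ltA) => //; rewrite /g /=.
case: pickP => [B /eqP eqB | /(_ A)]; last by rewrite eqxx.
have [t tBA] := exists_perm_imset eqB.
by apply/orbit_eqP; apply/orbitP; exists t; rewrite ?inE.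
Qed.

Lemma leq_card_inv_setsJ t x : #|inv_sets t| <= #|inv_sets (t ^ x)%g|.
Proof.
rewrite -(card_imset (inv_sets t) (imset_inj (@perm_inj _ x))).
apply: subset_leq_card; apply/subsetP => _ /imsetP[A + ->].
rewrite !inE -imset_comp => /eqP tA; rewrite -[in X in _ == X]tA -imset_comp.
by apply/eqP/eq_imset => z /=; rewrite permJ.
Qed.

(** Unions of fibres of [f] are invariant, and the points [h j] lie in distinct fibres, so each
    subset of [J] selects a different union. *)
Lemma leq_expn_card_inv_sets t (I J : finType) (f : T -> I) (h : J -> T) :
  (forall z, f (t z) = f z) -> injective (f \o h) ->
  2 ^ #|J| <= #|inv_sets t|.
Proof.
move=> ft fh_inj; pose g (D : {set J}) := [set z | f z \in (f \o h) @: D].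
have g_inj : injective g.
  move=> D E /setP eqDE; apply/setP => j; have := eqDE (h j).
  by rewrite !inE ![f (h j)]/((f \o h) j) !(mem_imset _ _ fh_inj).
rewrite -cardsT -card_powerset -(card_imset _ g_inj); apply: subset_leq_card.
apply/subsetP => _ /imsetP[D _ ->]; rewrite inE.
rewrite eqEcard card_imset ?leqnn ?andbT; last exact: perm_inj.
by apply/subsetP => _ /imsetP[z + ->]; rewrite !inE ft.
Qed.

Lemma card_inv_sets_markov (U : {set {perm T}}) k :
  (forall t, t \in U -> k <= #|inv_sets t|) ->
  #|U| * k <= #|T|.+1 * #|{perm T}|.
Proof.
move=> leU; apply: leq_trans sum_card_inv_sets.
rewrite -sum_nat_const big_mkcond /=.
by apply: leq_sum => t _; case: ifP => // /leU.
Qed.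

Lemma leq_card_porbits t q :
  (forall z, #|porbit t z| <= q) -> #|T| <= #|porbits t| * q.
Proof.
move=> le_q; rewrite -[leqLHS]sum1_card.
rewrite (partition_big (porbit t) (mem (porbits t))) => [|z _] /=;
  last exact: imset_f.
rewrite -sum_nat_const; apply: leq_sum => _ /imsetP[z _ ->].
apply: leq_trans (le_q z); rewrite sum1_card; apply: subset_leq_card.
by apply/subsetP => y; rewrite -eq_porbit_mem.
Qed.

Lemma iter_porbit_inj t z i j :
  i < #|porbit t z| -> j < #|porbit t z| -> iter i t z = iter j t z -> i = j.
Proof.
move=> lti ltj; rewrite -(nth_traject t lti) -(nth_traject t ltj) => /eqP.
by rewrite nth_uniq ?size_traject ?uniq_traject_porbit // => /eqP.
Qed.

End InvariantSets.

(** * Graphs invariant under a vertex permutation *)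

Section InvariantGraphs.
Variables (m : nat) (s : 'S_m).

Let sp := actperm (pair_action m) s.

Lemma leq_expn_card_inv_graphs (I J : finType)
    (f : {set 'I_m} -> I) (h : J -> {set 'I_m}) :
  (forall A : {set _}, f (s @: A) = f A) -> (forall j, #|h j| == 2) ->
  injective (f \o h) -> 2 ^ #|J| <= #|inv_sets sp|.
Proof.
move=> fs h2 fh_inj.
apply: (@leq_expn_card_inv_sets _ _ I J (fun i => f (val (pair_val i)))
  (fun j => pair_rank (exist _ (h j) (h2 j)))) => [i|j k].
  by rewrite /sp actpermE /= /pair_act pair_rankK /= fs.
by rewrite /= !pair_rankK /=; apply: fh_inj.
Qed.

(** The invariant of an edge is the set of cycles it meets; it separates the edges from a point [x]
    of a cycle [O] to representatives of the other cycles. *)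
Lemma leq_inv_graphs_porbits : 2 ^ #|porbits s|.-1 <= #|inv_sets sp|.
Proof.
(* Without cycles the truncated exponent is 0, and the empty graph suffices. *)
have [-> | [O /imsetP[x _ defO]]] := set_0Vmem (porbits s).
  rewrite cards0 card_gt0; apply/set0Pn.
  by exists set0; rewrite inE imset0.
have rep (P : {P | P \in porbits s :\ O}) : exists y, val P == porbit s y.
  by case: P => P /= /setD1P[_ /imsetP[y _ ->]]; exists y.
pose h P : {set 'I_m} := [set x; xchoose (rep P)].
have fh P : porbit s @: h P = [set O; val P].
  by rewrite imsetU1 imset_set1 -defO -(eqP (xchooseP (rep P))).
have -> : #|porbits s|.-1 = #|{: {P | P \in porbits s :\ O}}|.
  by rewrite card_sig [in LHS](cardsD1 O) defO imset_f.
apply: (@leq_expn_card_inv_graphs _ _ (fun A => porbit s @: A) h) => [A|P|P Q].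
- by rewrite -imset_comp; apply: eq_imset => y; apply: (porbit_perm s 1).
- rewrite cards2; case: (eqVneq x) => // eqx; have := xchooseP (rep P).
  by rewrite -eqx -defO; case: (P) => ? /= /setD1P[/negPf->].
- rewrite /= !fh => /setP/(_ (val P)); rewrite !inE eqxx orbT.
  case: (P) (Q) => [P' P'O] [Q' Q'O] /= /esym /orP[|/eqP eqPQ].
    by case/setD1P: (P'O) => /negPf->.
  exact: val_inj.
Qed.

(* The chords [{x, s^i x}] of one cycle are told apart by their length. *)
Lemma leq_inv_graphs_porbit x b :
  b.*2 < #|porbit s x| -> 2 ^ b <= #|inv_sets sp|.
Proof.
move=> ltb.
pose f (A : {set 'I_m}) := [set k : 'I_m | [exists y in A, iter k s y \in A]].
pose h (i : 'I_b) : {set 'I_m} := [set x; iter i.+1 s x].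
have lem : #|porbit s x| <= m by rewrite -[leqRHS]card_ord max_card.
have inj i j := @iter_porbit_inj _ s x i j.
rewrite -(card_ord b).
apply: (@leq_expn_card_inv_graphs _ _ f h) => [A|i|i j /setP eq_f].
- have iterC k y : iter k s (s y) = s (iter k s y) by rewrite -iterSr.
  apply/setP => k; rewrite !inE; apply/exists_inP/exists_inP; last first.
    move=> [y yA kyA].
    by exists (s y); rewrite ?iterC mem_imset //; exact: perm_inj.
  move=> [_ /imsetP[y yA ->]]; rewrite iterC mem_imset; last exact: perm_inj.
  by exists y.
- rewrite cards2; case: (eqVneq x) => // eqx; suff: 0 = i.+1 by [].
  by apply: (inj 0 i.+1) eqx; have := ltn_ord i; lia.
- have [ltib ltjb] := (ltn_ord i, ltn_ord j).
  have ltim : i.+1 < m by lia.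
  have: Ordinal ltim \in f (h j).
    by rewrite -eq_f inE; apply/exists_inP; exists x; rewrite !inE eqxx ?orbT.
  rewrite inE => /exists_inP[_ /set2P[]->];
    rewrite -[nat_of_ord _]/(i.+1) -?iterD.
    case/set2P => [/(inj i.+1 0)|/(inj i.+1 j.+1)] eqi;
      apply: val_inj => /=; lia.
  (* Starting from the far end of the chord, a return to [x] would need [i.+1 + j.+1] steps; this is
     at most [2b], hence less than the cycle length. *)
  case/set2P => [/(inj (i.+1 + j.+1) 0)|/(inj (i.+1 + j.+1) j.+1)] eqi;
    apply: val_inj => /=; lia.
Qed.

Lemma leq_inv_graphs b : b.*2.+1 ^ 2 <= m -> 2 ^ b <= #|inv_sets sp|.
Proof.
move=> le_m; case: (boolP [exists x, b.*2 < #|porbit s x|]) => [/existsP[x]|].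
  exact: leq_inv_graphs_porbit.
rewrite negb_exists => /forallP small.
have := @leq_card_porbits _ s b.*2; rewrite card_ord => le_porbits.
apply: leq_trans leq_inv_graphs_porbits; rewrite leq_exp2l //.
have: m <= #|porbits s| * b.*2.
  by apply: le_porbits => x; rewrite leqNgt small.
(* With at most [b] cycles, [m] would be at most [2b^2], less than [(2b+1)^2]. *)
by move: le_m; rewrite -mulnn; nia.
Qed.

End InvariantGraphs.

Lemma card_conjugates_union_pairs m b : b.*2.+1 ^ 2 <= m ->
  #|conjugates_union (S_on_pairs m)| * 2 ^ b <=
  'C(m, 2).+1 * #|{perm 'I_('C(m, 2))}|.
Proof.
move=> le_m; have := @card_inv_sets_markov 'I_('C(m, 2)).
rewrite card_ord; apply => t /bigcupP[x _ /imsetP[y + ->]].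
case/morphimP => s _ _ ->; apply: leq_trans (leq_card_inv_setsJ _ _).
exact: leq_inv_graphs.
Qed.

(** * Choice of [b] and growth estimates *)

Lemma exists_leq_expn_exp2 k : 0 < k ->
  exists C, forall b, b.*2.+3 ^ k <= C * 2 ^ b.
Proof.
(* With [q = b %/ k], [2b+3 <= (2k+3)(q+1) <= (2k+3) 2^q]; take [k]-th powers and use [qk <= b]. *)
move=> k_gt0; exists ((k.*2.+3) ^ k) => b.
apply: (@leq_trans ((k.*2.+3 * 2 ^ (b %/ k)) ^ k)); last first.
  by rewrite expnMn leq_mul2l -expnM leq_exp2l // leq_trunc_div orbT.
rewrite leq_exp2r //; have := ltn_expl (b %/ k) (isT : 1 < 2).
by have := divn_eq b k; have := ltn_pmod b k_gt0; nia.
Qed.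

Lemma exists_odd_sqrt m : 0 < m ->
  exists2 b, b.*2.+1 ^ 2 <= m & m < b.*2.+3 ^ 2.
Proof.
case: m => // m _; elim: m => [|m [b le_b lt_b]]; first by exists 0.
case: (ltnP m.+2 (b.*2.+3 ^ 2)) => [lt_m|le_m]; first by exists b; lia.
by exists b.+1; rewrite doubleS //; move: lt_b; rewrite -!mulnn; lia.
Qed.

Lemma exists_card_conjugates_union_pairs_bound :
  exists C, forall m, 0 < m ->
    #|conjugates_union (S_on_pairs m)| * 'C(m, 2) <=
    C * #|{perm 'I_('C(m, 2))}|.
Proof.
(* The exponent 8 comes from [(n+1) n <= m^4 <= (2b+3)^8], where [n = 'C(m, 2)]. *)
have [C leC] := @exists_leq_expn_exp2 8 isT; exists C => m m_gt0.
have [b /card_conjugates_union_pairs leU ltm] := exists_odd_sqrt m_gt0.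
have exp_gt0 : 0 < 2 ^ b by rewrite expn_gt0.
rewrite -(leq_pmul2r exp_gt0) mulnAC.
apply: (leq_trans (leq_mul leU (leqnn _))).
have leN : 'C(m, 2).+1 <= m ^ 2.
  by rewrite bin2 -divn2 -mulnn; have := leq_div (m * m.-1) 2; nia.
have leNN : 'C(m, 2).+1 * 'C(m, 2) <= C * 2 ^ b.
  apply: leq_trans (leC b); apply: (@leq_trans (m ^ 4)).
    by rewrite (expnD m 2 2) leq_mul // ltnW.
  by rewrite (expnM _ 2 4) leq_exp2r // ltnW.
by rewrite mulnAC [leqRHS]mulnAC leq_mul2r leNN orbT.
Qed.

(* Passage to the real asymptotic estimate *)
From mathcomp Require Import all_classical all_reals all_analysis.
Import Order.TTheory GRing.Theory Num.Theory.
Import numFieldNormedType.Exports.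
Local Open Scope classical_set_scope.
Local Open Scope ring_scope.

Theorem theorem7p3 (R : realType) :
  (fun m : nat => proportion R (conjugates_union (S_on_pairs m)) : R^o)
    =O_\oo
  (fun m : nat => ln ('C(m, 2)%:R : R) / 'C(m, 2)%:R : R^o).
Proof.
have ln2_gt0 : 0 < ln (2 : R) by rewrite ln_gt0 // ltr1n.
have [C leC] := exists_card_conjugates_union_pairs_bound.
(* The successor makes the constant positive even if [C] is 0; dividing by [ln 2] absorbs the
   logarithm, since [ln n >= ln 2]. *)
apply/eqO_exP; exists (C.+1%:R / ln 2).
  by rewrite divr_gt0 // ltr0n.
(* At [m = 2] one has [n = 1] and [ln n = 0]; from [m = 3] on, [n >= 2]. *)
exists 3%N => // m /= le3m.
have N_gt1 : (1 < 'C(m, 2))%N by apply: leq_trans (leq_bin2l 2 le3m).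
have N_gt0 : 0 < 'C(m, 2)%:R :> R by rewrite ltr0n ltnW.
have P_gt0 : 0 < #|{perm 'I_('C(m, 2))}|%:R :> R.
  by rewrite ltr0n; apply/card_gt0P; exists 1%g.
have lnN : ln 2 <= ln ('C(m, 2)%:R : R).
  by rewrite ler_ln ?posrE ?ler_nat ?ltr0n ?(ltnW N_gt1).
rewrite /proportion ger0_norm ?divr_ge0 ?ler0n //.
have lnN_ge0 : 0 <= ln ('C(m, 2)%:R : R) := le_trans (ltW ln2_gt0) lnN.
rewrite ger0_norm ?divr_ge0 ?ler0n //.
apply: (@le_trans _ _ (C.+1%:R / 'C(m, 2)%:R)).
  rewrite ler_pdivrMr // mulrAC ler_pdivlMr // -!natrM ler_nat.
  apply: leq_trans (leC m (leq_trans _ le3m)) _ => //.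
  by rewrite leq_mul2r leqnSn orbT.
rewrite mulrA ler_pM2r ?invr_gt0 // -mulrA ler_peMr ?ler0n //.
by rewrite mulrC ler_pdivlMr // mul1r.
Qed.
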